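(* Let $({\bf H}^n,{\bf E}^n)_{0\le n\le M}$ be the solution of the scheme $$\mu\,\frac{{\bf H}^{n+1}-{\bf H}^n}{\tau}=-\hat{\bf D}\,\frac{{\bf E}^{n+1}+{\bf E}^n}{2},\qquad \epsilon\,\frac{{\bf E}^{n+1}-{\bf E}^n}{\tau}=\hat{\bf D}\,\frac{{\bf H}^{n+1}+{\bf H}^n}{2},\qquad n=0,\dots,M-1 .$$ Then for each $w\in\{x,y,z\}$ the discrete momentum conservation law holds: $$\mathcal M_w^{n+1}=\mathcal M_w^n,\qquad \mathcal M_w^n=\langle{\bf H}^n,{\bf M}_w{\bf E}^n\rangle_h,\qquad n=0,\dots,M-1,$$ where ${\bf M}_x=\mathrm{diag}({\bf D}_1,{\bf D}_1,{\bf D}_1)$, ${\bf M}_y=\mathrm{diag}({\bf D}_2,{\bf D}_2,{\bf D}_2)$, ${\bf M}_z=\mathrm{diag}({\bf D}_3,{\bf D}_3,{\bf D}_3)$ (block diagonal matrices).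
   Context: Grid: $N_x,N_y,N_z$ are even positive integers, the domain is $[x_L,x_R]\times[y_L,y_R]\times[z_L,z_R]$, $L_w=w_R-w_L$, $h_w=L_w/N_w$, $\mu_w=2\pi/L_w$ for $w\in\{x,y,z\}$; $w_j=w_L+(j-1)h_w$, $j=1,\dots,N_w$. Time step $\tau=T/M$, $T>0$, $M$ a positive integer. $\epsilon,\mu>0$ are constants and $c=1/\sqrt{\epsilon\mu}$. Put $s_1=N_xN_yN_z$. ${\bf D}_1^w\in\mathbb R^{N_w\times N_w}$ is the Fourier spectral first-order differentiation matrix: $({\bf D}_1^w)_{j,l}=\tfrac12\mu_w(-1)^{j+l}\cot\big(\mu_w\tfrac{w_j-w_l}{2}\big)$ for $j\ne l$, and $({\bf D}_1^w)_{j,j}=0$. Put ${\bf D}_1={\bf I}_{N_z}\otimes{\bf I}_{N_y}\otimes{\bf D}_1^x$, ${\bf D}_2={\bf I}_{N_z}\otimes{\bf D}_1^y\otimes{\bf I}_{N_x}$, ${\bf D}_3={\bf D}_1^z\otimes{\bf I}_{N_y}\otimes{\bf I}_{N_x}$ ($\otimes$ the Kronecker product), acting on grid functions $U_{j,k,m}$ ordered as vectors in $\mathbb R^{s_1}$ with $j$ varying fastest, then $k$, then $m$. Let $${\bf D}=\begin{pmatrix}0&-{\bf D}_3&{\bf D}_2\\ {\bf D}_3&0&-{\bf D}_1\\ -{\bf D}_2&{\bf D}_1&0\end{pmatrix},\qquad \hat{\bf D}={\bf D}+\frac{c^2\tau^2}{12}{\bf D}^3+\frac{c^4\tau^4}{120}{\bf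 D}^5 .$$ Unknowns ${\bf H}^n=(({\bf H}_x^n)^T,({\bf H}_y^n)^T,({\bf H}_z^n)^T)^T$ and ${\bf E}^n=(({\bf E}_x^n)^T,({\bf E}_y^n)^T,({\bf E}_z^n)^T)^T$ lie in $\mathbb R^{3s_1}$. For grid functions, $\langle{\bf U},{\bf V}\rangle_h=h_xh_yh_z\sum_{j,k,m}U_{j,k,m}\overline{V_{j,k,m}}$; for three-component vectors $\langle{\bf U},{\bf V}\rangle_h=\sum_{w\in\{x,y,z\}}\langle{\bf U}_w,{\bf V}_w\rangle_h$. *)

(* Defs.v *)
From HB Require Import structures.
From mathcomp Require Import all_boot all_order all_algebra.
From mathcomp Require Import mxtens.
From mathcomp Require Import reals trigo.

Set Implicit Arguments.
Unset Strict Implicit.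
Unset Printing Implicit Defensive.

Import Order.TTheory GRing.Theory Num.Theory.
Local Open Scope ring_scope.


Variant axis := AxisX | AxisY | AxisZ.

Definition cot (R : realType) (x : R) : R := cos x / sin x.

Definition mesh_step (R : realType) (wL wR : R) (N : nat) : R :=
  (wR - wL) / N%:R.

(* Indices are 0-based: [node j] is w_(j+1) in the 1-based numbering. *)
Definition node (R : realType) (wL wR : R) (N : nat) (j : 'I_N) : R :=
  wL + j%:R * mesh_step wL wR N.

Definition wave_unit (R : realType) (wL wR : R) : R := 2 * pi / (wR - wL).

(* Shifting both indices by one leaves the sign (-1)^(j+l) unchanged. *)
Definition fourier_diff (R : realType) (wL wR : R) (N : nat) : 'M[R]_N :=
  \matrix_(j, l)
    if j == l then 0
    else 2^-1 * wave_unit wL wR * (-1) ^+ (j + l) *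
         cot (wave_unit wL wR * ((node wL wR j - node wL wR l) / 2)).

Definition grid_size (N : axis -> nat) : nat := N AxisZ * N AxisY * N AxisX.

(* Position of the value U_(j,k,m): j varies fastest, then k, then m. *)
Definition grid_index (N : axis -> nat)
    (j : 'I_(N AxisX)) (k : 'I_(N AxisY)) (m : 'I_(N AxisZ)) :
    'I_(grid_size N) :=
  mxtens_index (mxtens_index (m, k), j).

Definition field_size (N : axis -> nat) : nat :=
  grid_size N + (grid_size N + grid_size N).

Definition grid_diff (R : realType) (wL wR : axis -> R) (N : axis -> nat)
    (w : axis) : 'M[R]_(grid_size N) :=
  let d v := fourier_diff (wL v) (wR v) (N v) in
  match w with
  | AxisX => 1%:M *t 1%:M *t d AxisX
  | AxisY => 1%:M *t d AxisY *t 1%:M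
  | AxisZ => d AxisZ *t 1%:M *t 1%:M
  end.

Definition block3_mx (R : realType) (s : nat)
    (A11 A12 A13 A21 A22 A23 A31 A32 A33 : 'M[R]_s) : 'M[R]_(s + (s + s)) :=
  col_mx (row_mx A11 (row_mx A12 A13))
    (col_mx (row_mx A21 (row_mx A22 A23))
            (row_mx A31 (row_mx A32 A33))).

Definition curl_mx (R : realType) (wL wR : axis -> R) (N : axis -> nat) :
    'M[R]_(field_size N) :=
  let D1 := grid_diff wL wR N AxisX in
  let D2 := grid_diff wL wR N AxisY in
  let D3 := grid_diff wL wR N AxisZ in
  block3_mx
       0    (- D3)    D2
      D3       0   (- D1)
    (- D2)    D1       0.

Definition light_speed (R : realType) (eps mu : R) : R :=
  1 / Num.sqrt (eps * mu).

Definition curl_hat_mx (R : realType) (wL wR : axis -> R) (N : axis -> nat)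
    (eps mu tau : R) : 'M[R]_(field_size N) :=
  let c := light_speed eps mu in
  let D := curl_mx wL wR N in
  D + (c ^+ 2 * tau ^+ 2 / 12) *: D ^+ 3
    + (c ^+ 4 * tau ^+ 4 / 120) *: D ^+ 5.

Definition momentum_mx (R : realType) (wL wR : axis -> R) (N : axis -> nat)
    (w : axis) : 'M[R]_(field_size N) :=
  let Dw := grid_diff wL wR N w in
  block3_mx Dw 0 0
            0 Dw 0
            0 0 Dw.

Definition component (R : realType) (N : axis -> nat)
    (U : 'cV[R]_(field_size N)) (w : axis) : 'cV[R]_(grid_size N) :=
  match w with
  | AxisX => usubmx U
  | AxisY => usubmx (dsubmx U)
  | AxisZ => dsubmx (dsubmx U)
  end.

(* Grid functions are real-valued, so the complex conjugation on the second
   argument of the discrete inner product is the identity. *)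
Definition grid_inner (R : realType) (wL wR : axis -> R) (N : axis -> nat)
    (U V : 'cV[R]_(grid_size N)) : R :=
  let h w := mesh_step (wL w) (wR w) (N w) in
  h AxisX * h AxisY * h AxisZ *
  \sum_(j < N AxisX) \sum_(k < N AxisY) \sum_(m < N AxisZ)
    U (grid_index j k m) 0 * V (grid_index j k m) 0.

Definition field_inner (R : realType) (wL wR : axis -> R) (N : axis -> nat)
    (U V : 'cV[R]_(field_size N)) : R :=
  grid_inner wL wR (component U AxisX) (component V AxisX)
  + grid_inner wL wR (component U AxisY) (component V AxisY)
  + grid_inner wL wR (component U AxisZ) (component V AxisZ).

Definition momentum (R : realType) (wL wR : axis -> R) (N : axis -> nat)
    (H E : nat -> 'cV[R]_(field_size N)) (w : axis) (n : nat) : R :=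
  field_inner wL wR (H n) (momentum_mx wL wR N w *m E n).

Definition scheme_solution (R : realType) (wL wR : axis -> R)
    (N : axis -> nat) (eps mu tau : R) (M : nat)
    (H E : nat -> 'cV[R]_(field_size N)) : Prop :=
  let Dhat := curl_hat_mx wL wR N eps mu tau in
  forall n : nat, (n < M)%N ->
    mu *: (tau^-1 *: (H n.+1 - H n))
      = - (Dhat *m (2^-1 *: (E n.+1 + E n)))
    /\
    eps *: (tau^-1 *: (E n.+1 - E n))
      = Dhat *m (2^-1 *: (H n.+1 + H n)).

(* Main.v *)
Require Import Defs.
From HB Require Import structures.
From mathcomp Require Import all_boot all_order all_algebra.
From mathcomp Require Import mxtens ring.
From mathcomp Require Import reals trigo.

(** The identity is algebraic.  The matrices [D_1], [D_2], [D_3] are skew,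
    because [cot] is odd, and commute pairwise, because they act on different
    tensor factors.  The antisymmetric curl pattern of skew blocks makes [D],
    and hence the polynomial [Dhat] in [D], symmetric; the block diagonal
    [M_w] is skew and commutes with [D], hence with [Dhat].  Therefore
    [Dhat * M_w] is skew and its quadratic form vanishes ([skew_form_eq0]).

    Polarizing the bilinear form [<H, M_w E>] gives
      [2 (<H', M_w E'> - <H, M_w E>)
        = <H' - H, M_w (E' + E)> + <H' + H, M_w (E' - E)>],
    and the scheme makes [H' - H] a multiple of [Dhat (E' + E)] and [E' - E] a
    multiple of [Dhat (H' + H)].  Both terms on the right are then quadratic
    forms of [Dhat * M_w], so they are zero ([midpoint_step_conserves]). *)

Set Implicit Arguments.
Unset Strict Implicit.
Unset Printing Implicit Defensive.

Import Order.TTheory GRing.Theory Num.Theory.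
Local Open Scope ring_scope.

Lemma skew_form_eq0 (R : numDomainType) (n : nat) (S : 'M[R]_n) (u : 'cV[R]_n) :
  S^T = - S -> u^T *m S *m u = 0.
Proof.
move=> skS; apply/matrixP=> i j; rewrite !ord1 [RHS]mxE.
set A := u^T *m S *m u.
(* A 1 x 1 matrix equals its transpose, which here is its opposite. *)
have: A^T = - A by rewrite /A !trmx_mul trmxK skS mulNmx mulmxN mulmxA.
move/matrixP/(_ 0 0); rewrite [LHS]mxE [RHS]mxE => /eqP.
by rewrite -addr_eq0 -mulr2n mulrn_eq0 /= => /eqP.
Qed.

(** The factors [a] and [b] may be unrelated and of any sign: each increment
    only enters through a quadratic form of the skew matrix [D *m S], which
    vanishes whatever its coefficient. *)
Lemma midpoint_step_conserves (R : numDomainType) (n : nat) (D S : 'M[R]_n)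
    (a b : R) (H0 H1 E0 E1 : 'cV[R]_n) :
  D^T = D -> S^T = - S -> S *m D = D *m S ->
  H1 - H0 = a *: (D *m (E1 + E0)) -> E1 - E0 = b *: (D *m (H1 + H0)) ->
  H1^T *m S *m E1 = H0^T *m S *m E0.
Proof.
move=> symD skS comSD eH eE.
have skDS : (D *m S)^T = - (D *m S) by rewrite trmx_mul symD skS mulNmx comSD.
have H0S : (H1 - H0)^T *m S *m (E1 + E0) = 0.
  rewrite eH linearZ /= trmx_mul symD -!scalemxAl -[_ *m D *m S]mulmxA.
  by rewrite skew_form_eq0 ?scaler0.
have E0S : (H1 + H0)^T *m S *m (E1 - E0) = 0.
  rewrite eE -scalemxAr mulmxA -[_ *m S *m D]mulmxA comSD.
  by rewrite skew_form_eq0 ?scaler0.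
have polarize : (H1^T *m S *m E1 - H0^T *m S *m E0) *+ 2 = 0.
  rewrite -[RHS]addr0 -{2}E0S -H0S mulr2n linearB [(H1 + H0)^T]linearD /=.
  rewrite !(mulmxBl, mulmxDl) !(mulmxBr, mulmxDr).
  (* Once the four products are opaque, entrywise cancellation remains. *)
  move: (H1^T *m S *m E1) (H1^T *m S *m E0) (H0^T *m S *m E1)
        (H0^T *m S *m E0) => p q r t.
  by apply/matrixP=> i j; rewrite !mxE; ring.
apply/subr0_eq/matrixP=> i j; move/matrixP/(_ i j): polarize.
rewrite mulmxnE [RHS]mxE => /eqP.
by rewrite mulrn_eq0 => /eqP ->; rewrite mxE.
Qed.

Lemma trmx_exp (R : comPzRingType) (n : nat) (A : 'M[R]_n) (k : nat) :
  (A ^+ k)^T = A^T ^+ k.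
Proof.
by elim: k => [|k IHk]; rewrite ?trmx1 // exprS exprSr trmx_mul IHk.
Qed.

(** Transposing nested rows inside columns yields columns inside rows; the
    2 x 2 block form is stable under transposition. *)
Lemma block3_mxE (R : realType) (s : nat)
    (A11 A12 A13 A21 A22 A23 A31 A32 A33 : 'M[R]_s) :
  block3_mx A11 A12 A13 A21 A22 A23 A31 A32 A33 =
  block_mx A11 (row_mx A12 A13) (col_mx A21 A31) (block_mx A22 A23 A32 A33).
Proof. by rewrite /block3_mx block_mxEv -block_mxEv block_mxEh -block_mxEv. Qed.

Lemma tr_block3_mx (R : realType) (s : nat)
    (A11 A12 A13 A21 A22 A23 A31 A32 A33 : 'M[R]_s) :
  (block3_mx A11 A12 A13 A21 A22 A23 A31 A32 A33)^T =
  block3_mx A11^T A21^T A31^T A12^T A22^T A32^T A13^T A23^T A33^T.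
Proof. by rewrite !block3_mxE !tr_block_mx tr_row_mx tr_col_mx. Qed.

Lemma opp_block3_mx (R : realType) (s : nat)
    (A11 A12 A13 A21 A22 A23 A31 A32 A33 : 'M[R]_s) :
  - block3_mx A11 A12 A13 A21 A22 A23 A31 A32 A33 =
  block3_mx (- A11) (- A12) (- A13) (- A21) (- A22) (- A23)
            (- A31) (- A32) (- A33).
Proof. by rewrite /block3_mx !(opp_col_mx, opp_row_mx). Qed.

Lemma mul_diag_block3_mx (R : realType) (s : nat)
    (S A11 A12 A13 A21 A22 A23 A31 A32 A33 : 'M[R]_s) :
  block3_mx S 0 0 0 S 0 0 0 S *m
    block3_mx A11 A12 A13 A21 A22 A23 A31 A32 A33 =
  block3_mx (S *m A11) (S *m A12) (S *m A13) (S *m A21) (S *m A22) (S *m A23)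
            (S *m A31) (S *m A32) (S *m A33).
Proof.
rewrite /block3_mx !(mul_col_mx, mul_row_col, mul_mx_row) !mul0mx.
by rewrite !row_mx0 !(add0r, addr0).
Qed.

Lemma mul_block3_diag_mx (R : realType) (s : nat)
    (S A11 A12 A13 A21 A22 A23 A31 A32 A33 : 'M[R]_s) :
  block3_mx A11 A12 A13 A21 A22 A23 A31 A32 A33 *m
    block3_mx S 0 0 0 S 0 0 0 S =
  block3_mx (A11 *m S) (A12 *m S) (A13 *m S) (A21 *m S) (A22 *m S) (A23 *m S)
            (A31 *m S) (A32 *m S) (A33 *m S).
Proof.
rewrite /block3_mx !(mul_col_mx, mul_row_col, mul_mx_row) !mulmx0.
by rewrite !add_row_mx !(add0r, addr0).
Qed.

(** The sign and the prefactor are symmetric in the two indices, so the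
    skewness is exactly the oddness of [cot]. *)
Lemma fourier_diff_skew (R : realType) (wL wR : R) (N : nat) :
  (fourier_diff wL wR N)^T = - fourier_diff wL wR N.
Proof.
apply/matrixP=> j l; rewrite !mxE eq_sym; case: eqP => _; first by rewrite oppr0.
rewrite addnC -[in LHS]opprB mulNr mulrN /cot sinN cosN invrN.
by rewrite !mulrN.
Qed.

Lemma grid_diff_skew (R : realType) (wL wR : axis -> R) (N : axis -> nat)
    (w : axis) :
  (grid_diff wL wR N w)^T = - grid_diff wL wR N w.
Proof.
have skD v := fourier_diff_skew (wL v) (wR v) (N v).
case: w; rewrite /grid_diff !trmx_tens !trmx1 skD; apply/matrixP=> i j.
- by rewrite !mxE mulrN.
- by rewrite !mxE mulrN mulNr.
- by rewrite !mxE !mulNr.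
Qed.

(** Different axes act on different tensor factors, where one of the two
    matrices is the identity. *)
Lemma grid_diff_comm (R : realType) (wL wR : axis -> R) (N : axis -> nat)
    (v w : axis) :
  grid_diff wL wR N v *m grid_diff wL wR N w =
  grid_diff wL wR N w *m grid_diff wL wR N v.
Proof.
by case: v; case: w; rewrite /grid_diff // !tensmx_mul !mul1mx !mulmx1.
Qed.

Lemma sum_mxtens_index (V : nmodType) (m n : nat) (F : 'I_(m * n) -> V) :
  \sum_(i < m) \sum_(j < n) F (mxtens_index (i, j)) = \sum_k F k.
Proof.
rewrite pair_big [RHS](reindex (@mxtens_index m n)) /=.
  by apply: eq_bigr => -[].
by exists (@mxtens_unindex m n) => i _; rewrite (mxtens_indexK, mxtens_unindexK).
Qed.

(** The nested sums of the discrete inner product visit each entry of the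
    flat vector once; this lets the inner product be written as a matrix
    product. *)
Lemma sum_grid_index (V : nmodType) (N : axis -> nat)
    (F : 'I_(grid_size N) -> V) :
  \sum_(j < N AxisX) \sum_(k < N AxisY) \sum_(m < N AxisZ)
    F (grid_index j k m) = \sum_i F i.
Proof.
under eq_bigr => j _.
  rewrite exchange_big (sum_mxtens_index (fun q => F (mxtens_index (q, j)))).
  over.
by rewrite exchange_big sum_mxtens_index.
Qed.

Lemma field_innerE (R : realType) (wL wR : axis -> R) (N : axis -> nat)
    (U V : 'cV[R]_(field_size N)) :
  let h w := mesh_step (wL w) (wR w) (N w) in
  field_inner wL wR U V =
  h AxisX * h AxisY * h AxisZ * (U^T *m V) 0 0.
Proof.
move=> h; rewrite /field_inner /grid_inner.
have flat w :=
  sum_grid_index (fun i => component U w i 0 * component V w i 0).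
rewrite !flat.
rewrite -!mulrDr; congr (_ * _).
rewrite mxE big_split_ord /= big_split_ord /= addrA.
by congr (_ + _ + _); apply: eq_bigr => i _; rewrite !mxE.
Qed.

Lemma curl_mx_sym (R : realType) (wL wR : axis -> R) (N : axis -> nat) :
  (curl_mx wL wR N)^T = curl_mx wL wR N.
Proof.
have trN (A : 'M[R]_(grid_size N)) : (- A)^T = - A^T by rewrite linearN.
by rewrite /curl_mx tr_block3_mx !trN !trmx0 !grid_diff_skew !opprK.
Qed.

Lemma momentum_mx_skew (R : realType) (wL wR : axis -> R) (N : axis -> nat)
    (w : axis) :
  (momentum_mx wL wR N w)^T = - momentum_mx wL wR N w.
Proof.
by rewrite /momentum_mx tr_block3_mx opp_block3_mx !trmx0 !oppr0 grid_diff_skew.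
Qed.

(** Entrywise in the blocks: [M_w] multiplies every block of the curl by the
    same [D_w], which commutes with each of them. *)
Lemma momentum_curl_comm (R : realType) (wL wR : axis -> R) (N : axis -> nat)
    (w : axis) :
  momentum_mx wL wR N w *m curl_mx wL wR N =
  curl_mx wL wR N *m momentum_mx wL wR N w.
Proof.
rewrite /momentum_mx /curl_mx mul_diag_block3_mx mul_block3_diag_mx.
by rewrite !(mulmx0, mul0mx) !(mulmxN, mulNmx) !(grid_diff_comm _ _ _ w).
Qed.

Lemma curl_hat_sym (R : realType) (wL wR : axis -> R) (N : axis -> nat)
    (eps mu tau : R) :
  (curl_hat_mx wL wR N eps mu tau)^T = curl_hat_mx wL wR N eps mu tau.
Proof.
by rewrite /curl_hat_mx !linearD /= !linearZ /= !trmx_exp curl_mx_sym.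
Qed.

Lemma momentum_curl_hat_comm (R : realType) (wL wR : axis -> R)
    (N : axis -> nat) (eps mu tau : R) (w : axis) :
  momentum_mx wL wR N w *m curl_hat_mx wL wR N eps mu tau =
  curl_hat_mx wL wR N eps mu tau *m momentum_mx wL wR N w.
Proof.
have comX k : momentum_mx wL wR N w *m curl_mx wL wR N ^+ k =
              curl_mx wL wR N ^+ k *m momentum_mx wL wR N w.
  exact: commrX (momentum_curl_comm wL wR N w).
rewrite /curl_hat_mx !mulmxDr !mulmxDl -!scalemxAr -!scalemxAl !comX.
by rewrite momentum_curl_comm.
Qed.

Theorem theorem4p5 (R : realType) (N : axis -> nat) (wL wR : axis -> R)
    (T eps mu : R) (M : nat)
    (N_gt0 : forall w : axis, (0 < N w)%N)
    (N_even : forall w : axis, ~~ odd (N w))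
    (wLR : forall w : axis, wL w < wR w)
    (T_gt0 : 0 < T) (M_gt0 : (0 < M)%N)
    (eps_gt0 : 0 < eps) (mu_gt0 : 0 < mu)
    (H E : nat -> 'cV[R]_(field_size N))
    (HE : scheme_solution wL wR eps mu (T / M%:R) M H E) :
  forall (w : axis) (n : nat), (n < M)%N ->
    momentum wL wR H E w n.+1 = momentum wL wR H E w n.
Proof.
move=> w n /HE [eqH eqE]; rewrite /momentum !field_innerE !mulmxA.
have tau_neq0 : T / M%:R != 0.
  by rewrite mulf_neq0 ?invr_neq0 ?gt_eqF // ltr0n.
have solve (k : R) (x y : 'cV[R]_(field_size N)) :
    0 < k -> k *: ((T / M%:R)^-1 *: x) = y -> x = ((T / M%:R) * k^-1) *: y.
  move=> k_gt0 <-; rewrite !scalerA divfK ?gt_eqF //.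
  by rewrite divff // scale1r.
congr (_ * fun_of_matrix _ _ _).
apply: (midpoint_step_conserves (curl_hat_sym wL wR N eps mu (T / M%:R))
  (momentum_mx_skew wL wR N w) (momentum_curl_hat_comm _ _ _ _ _ _ w)).
(* The scalars of the increments are read off by unification. *)
- rewrite (solve _ _ _ mu_gt0 eqH) -scalemxAr -scaleNr scalerA.
  reflexivity.
- by rewrite (solve _ _ _ eps_gt0 eqE) -scalemxAr scalerA; reflexivity.
Qed.
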